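(* The bound $c\in\mathcal{O}(\lambda\sqrt n)$ on the packedness $c$ of $n$-vertex geometric graphs with $\lambda$-low density is tight: the $(\sqrt n\times\sqrt n)$-grid graph (for $n$ a perfect square) has $\lambda$-low density for some constant $\lambda\in\mathcal{O}(1)$ independent of $n$, but its packedness (the smallest $c$ such that it is $c$-packed) is $\Theta(\sqrt n)$.
   Context: A geometric graph is a finite simple undirected graph embedded in the plane: each vertex is associated with a point in $\mathbb{R}^2$, each edge is a straight-line segment between its endpoints and has its Euclidean length. Squares are axis-aligned, and the radius of a square is half its side length. A geometric graph $G$ has $\lambda$-low density if for each square $S$ of radius $r$ (for every $r>0$) there are at most $\lambda$ edges of $G$ that have length greater than $r$ and intersect $S$. A geometric graph $G$ is $c$-packed if for each square $S$ of radius $r$ (for every $r>0$) the total length of the edges of $G$ clipped to $S$ is at most $cr$. The $(\sqrt n\times\sqrt n)$-grid graph has vertex set $\{1,\dots,\sqrt n\}^2\subset\mathbb{R}^2$, with two vertices adjacent if and only if their Euclidean distance is $1$. *)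

(* Defs.v *)
From HB Require Import structures.
From mathcomp Require Import all_boot all_order all_algebra.
From mathcomp Require Import all_classical all_reals all_analysis.

Set Implicit Arguments.
Unset Strict Implicit.
Unset Printing Implicit Defensive.

Import Order.TTheory GRing.Theory Num.Theory.
Import numFieldNormedType.Exports.

Local Open Scope classical_set_scope.
Local Open Scope ring_scope.

Section Plane.
Variable R : realType.
Implicit Types (p q a : R * R) (r t : R).

(* The norm of the product type [R * R] is the max norm, so the Euclidean
   distance is written out. *)
Definition eucl_dist p q : R :=
  Num.sqrt ((p.1 - q.1) ^+ 2 + (p.2 - q.2) ^+ 2).

Definition seg_point p q t : R * R :=
  (line_path p.1 q.1 t, line_path p.2 q.2 t).

Definition segment p q : set (R * R) := seg_point p q @` `[0, 1].

Definition square a r : set (R * R) :=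
  [set p | `|p.1 - a.1| <= r /\ `|p.2 - a.2| <= r].

(* Length of [segment p q `&` S]: [seg_point p q] runs through the segment at
   constant speed [eucl_dist p q]. The measure is finite since the set of
   parameters lies in [0, 1]. *)
Definition clipped_length (S : set (R * R)) p q : R :=
  eucl_dist p q *
  fine (lebesgue_measure (`[0, 1] `&` seg_point p q @^-1` S)).

End Plane.

(* Edges may cross; "embedded" only asks that distinct vertices have distinct
   positions. *)
Record geometric_graph (R : realType) := GeometricGraph {
  vertex : finType;
  adj : rel vertex;
  adj_sym : symmetric adj;
  adj_irr : irreflexive adj;
  pos : vertex -> R * R;
  pos_inj : injective pos
}.

Section GeometricGraph.
Variables (R : realType) (G : geometric_graph R).
Implicit Types (e : vertex G * vertex G) (c lam : R).

(* Each undirected edge is represented once, by its ordered pair of endpoints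
   that is increasing for the enumeration of the vertices. The notions below
   are invariant under exchanging the endpoints. *)
Definition edges : {set vertex G * vertex G} :=
  [set e | adj e.1 e.2 && (enum_rank e.1 < enum_rank e.2)%N]%SET.

Definition edge_segment e : set (R * R) := segment (pos e.1) (pos e.2).

Definition edge_length e : R := eucl_dist (pos e.1) (pos e.2).

Definition low_density lam : Prop :=
  forall (a : R * R) (r : R), 0 < r ->
    #|[set e in edges | (r < edge_length e) &&
         `[< edge_segment e `&` square a r !=set0 >] ]%SET|%:R <= lam.

Definition packed c : Prop :=
  forall (a : R * R) (r : R), 0 < r ->
    \sum_(e in edges) clipped_length (square a r) (pos e.1) (pos e.2)
      <= c * r.

Definition is_packedness c : Prop :=
  packed c /\ forall c', packed c' -> c <= c'.

End GeometricGraph.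

Section Grid.
Variables (R : realType) (k : nat).

(* Coordinates 0, ..., k - 1 in ['I_k] stand for 1, ..., k. *)
Definition grid_pos (v : 'I_k * 'I_k) : R * R := (v.1.+1%:R, v.2.+1%:R).

Definition grid_adj : rel ('I_k * 'I_k) :=
  fun u v => eucl_dist (grid_pos u) (grid_pos v) == 1.

Lemma grid_adj_sym : symmetric grid_adj.
Proof.
move=> u v; rewrite /grid_adj /eucl_dist.
by rewrite -[X in X ^+ 2 + _]opprB -[X in _ + X ^+ 2]opprB !sqrrN.
Qed.

Lemma grid_adj_irr : irreflexive grid_adj.
Proof.
move=> u; rewrite /grid_adj /eucl_dist !subrr expr0n /= addr0 sqrtr0.
by rewrite eq_sym oner_eq0.
Qed.

Lemma grid_pos_inj : injective grid_pos.
Proof.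
move=> [u1 u2] [v1 v2] [] /eqP + /eqP.
by rewrite !eqr_nat !eqSS => /eqP/val_inj-> /eqP/val_inj->.
Qed.

Definition grid : geometric_graph R :=
  GeometricGraph grid_adj_sym grid_adj_irr grid_pos_inj.

End Grid.

(* Main.v *)
(** Let a square [S] of radius [r] be fixed. Cutting [S] into [J^2] squares of
    radius [r / J] shows that at most [lam * J^2] edges longer than [r / J] meet
    [S], and each edge contributes at most [4 * r] to the clipped length. Hence
    the edges longer than [r] contribute [O(lam * r)], and those longer than
    [r / m] but no longer than [r] contribute, by Abel summation,
    [\sum_(j < m) r / (j.+1 * j.+2) * lam * j.+2 ^ 2 = O(lam * r * m)]. The
    remaining edges have length at most [r / m], and there are at most
    [lam * n] of them because low density bounds every degree by [lam]; the
    choice of [m] near [sqrt n] balances the two terms.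

    For the grid, a square of radius [k] around the origin contains all of the
    edges, and there are at least [k * (k - 1) / 2] of them. *)
Require Import Defs.
From HB Require Import structures.
From mathcomp Require Import all_boot all_order all_algebra.
From mathcomp Require Import all_classical all_reals all_analysis.
From mathcomp Require Import ring lra zify.
Import Order.TTheory GRing.Theory Num.Theory.
Import numFieldNormedType.Exports.
Local Open Scope classical_set_scope.
Local Open Scope ring_scope.

(** * Distances and clipped lengths of segments *)

Lemma eucl_dist_ge0 (R : realType) (p q : R * R) : 0 <= eucl_dist p q.
Proof. exact: sqrtr_ge0. Qed.

Lemma eucl_dist_gt0 (R : realType) (p q : R * R) : p != q -> 0 < eucl_dist p q.
Proof.
case: p q => p1 p2 [q1 q2]; rewrite xpair_eqE => pq.
rewrite sqrtr_gt0 /= lt0r paddr_eq0 ?sqr_ge0 // !sqrf_eq0 !subr_eq0 pq /=.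
by rewrite addr_ge0 ?sqr_ge0.
Qed.

Lemma eucl_dist_coord1 (R : realType) (p q : R * R) :
  `|q.1 - p.1| <= eucl_dist p q.
Proof.
by rewrite distrC -sqrtr_sqr /eucl_dist ler_sqrt ?addr_ge0 ?sqr_ge0 // lerDl sqr_ge0.
Qed.

Lemma eucl_dist_coord2 (R : realType) (p q : R * R) :
  `|q.2 - p.2| <= eucl_dist p q.
Proof.
by rewrite distrC -sqrtr_sqr /eucl_dist ler_sqrt ?addr_ge0 ?sqr_ge0 // lerDr sqr_ge0.
Qed.

(** Any factor from [sqrt 2] on would do; 2 keeps the constants rational. *)
Lemma eucl_dist_le_max (R : realType) (p q : R * R) (d : R) :
  `|q.1 - p.1| <= d -> `|q.2 - p.2| <= d -> eucl_dist p q <= 2 * d.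
Proof.
move=> h1 h2; have d0 : 0 <= d by exact: le_trans h1.
have d2 : 0 <= 2 * d by lra.
rewrite /eucl_dist -[leRHS]ger0_norm // -sqrtr_sqr.
rewrite ler_sqrt ?sqr_ge0 //.
move: h1 h2; rewrite !ler_norml => /andP[? ?] /andP[? ?]; nra.
Qed.

Definition clip_params {R : realType} (S : set (R * R)) (p q : R * R) : set R :=
  `[0, 1] `&` seg_point p q @^-1` S.

Lemma clip_params_square (R : realType) (p q a : R * R) (r t : R) :
  clip_params (square a r) p q t <->
  [/\ 0 <= t <= 1, `|p.1 - a.1 + t * (q.1 - p.1)| <= r &
      `|p.2 - a.2 + t * (q.2 - p.2)| <= r].
Proof.
rewrite /clip_params /square /seg_point /line_path /=.
have E (x y b : R) : (1 - t) * x + t * y - b = x - b + t * (y - x) by ring.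
rewrite !E in_itv /=; split; first by case=> ? [].
by case.
Qed.

(** Squares are convex, so the parameters form an interval. *)
Lemma clip_params_measurable (R : realType) (p q a : R * R) (r : R) :
  measurable (clip_params (square a r) p q).
Proof.
apply: measurable_realfun.is_interval_measurable => x y /clip_params_square[xI x1 x2].
move=> /clip_params_square[yI y1 y2] z /andP[xz zy].
have conv (u d : R) : `|u + x * d| <= r -> `|u + y * d| <= r ->
    `|u + z * d| <= r.
  rewrite !ler_norml => /andP[? ?] /andP[? ?].
  by apply/andP; case: (lerP 0 d) => ?; split; nra.
apply/clip_params_square; split; [lra| exact: conv|exact: conv].
Qed.

Lemma lebesgue_le_itv (R : realType) (A : set R) (x y : R) :
  x <= y -> measurable A -> A `<=` `[x, y] ->
  fine (lebesgue_measure A) <= y - x.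
Proof.
move=> xy mA Axy.
have mu_itv : lebesgue_measure `[x, y] = (y - x)%:E.
  rewrite lebesgue_measure_itv /= lte_fin; case: ltgtP xy => // -> _.
  by rewrite subrr.
have le_mu : (lebesgue_measure A <= (y - x)%:E)%E.
  by rewrite -mu_itv; apply: le_measure; rewrite ?inE.
(* [fine] sends infinity to 0, so the measure must be shown finite first. *)
rewrite -lee_fin fineK //; apply/fin_numPlt.
rewrite (lt_le_trans (ltNyr 0)) ?measure_ge0 //=.
exact: le_lt_trans le_mu (ltry _).
Qed.

Lemma clipped_length_ge0 (R : realType) (S : set (R * R)) (p q : R * R) :
  0 <= clipped_length S p q.
Proof. by rewrite mulr_ge0 ?eucl_dist_ge0 // fine_ge0. Qed.

Lemma clipped_length_le_dist (R : realType) (p q a : R * R) (r : R) :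
  clipped_length (square a r) p q <= eucl_dist p q.
Proof.
rewrite ler_piMr ?eucl_dist_ge0 // -[leRHS]subr0.
by apply: lebesgue_le_itv => //; exact: clip_params_measurable.
Qed.

Lemma clipped_length_subset (R : realType) (S : set (R * R)) (p q : R * R) :
  segment p q `<=` S -> clipped_length S p q = eucl_dist p q.
Proof.
move=> sS; rewrite /clipped_length setIidl; last first.
  by move=> t tI; apply: sS; exists t.
by rewrite lebesgue_measure_itv /= lte_fin ltr01 /= oppr0 addr0 mulr1.
Qed.

Lemma clipped_length_disjoint (R : realType) (S : set (R * R)) (p q : R * R) :
  ~ (segment p q `&` S !=set0) -> clipped_length S p q = 0.
Proof.
move=> pqS; rewrite /clipped_length (_ : _ `&` _ = set0) ?measure0 ?mulr0 //.
by rewrite -subset0 => t [tI tS]; apply: pqS; exists (seg_point p q t); split=> //; exists t.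
Qed.

(** An affine function of nonzero slope [d] has absolute value at most [r] only on an interval of
    length [2 * r / |d|] around its zero. *)
Lemma clip_measure_mul_le (R : realType) (A : set R) (u d r : R) :
  0 < r -> measurable A -> (forall t, A t -> `|u + t * d| <= r) ->
  `|d| * fine (lebesgue_measure A) <= 2 * r.
Proof.
move=> r0 mA Ar; have [->|d0] := eqVneq d 0; first by rewrite normr0; lra.
have nd0 : 0 < `|d| by rewrite normr_gt0.
rewrite mulrC -ler_pdivlMr //.
have rd : 0 < r / `|d| by rewrite divr_gt0.
have -> : 2 * r / `|d| = (- u / d + r / `|d|) - (- u / d - r / `|d|) by ring.
apply: lebesgue_le_itv => //; first lra.
move=> t /Ar h; rewrite /= in_itv /=.
suff : `|t - (- u / d)| <= r / `|d| by rewrite ler_norml; lra.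
rewrite ler_pdivlMr // -normrM (_ : _ * d = u + t * d) //.
by field.
Qed.

(** The one-dimensional bound [2 * r] applies to the larger coordinate extent, and the Euclidean
    length is at most twice that extent. *)
Lemma clipped_length_le_radius (R : realType) (p q a : R * R) (r : R) :
  0 < r -> clipped_length (square a r) p q <= 4 * r.
Proof.
move=> r0; rewrite /clipped_length -/(clip_params (square a r) p q).
set A := clip_params _ _ _; set m := fine _.
have m0 : 0 <= m by exact: fine_ge0.
have mA : measurable A by exact: clip_params_measurable.
have h1 : `|q.1 - p.1| * m <= 2 * r.
  by apply: (@clip_measure_mul_le _ _ (p.1 - a.1)) => // t /clip_params_square[].
have h2 : `|q.2 - p.2| * m <= 2 * r.
  by apply: (@clip_measure_mul_le _ _ (p.2 - a.2)) => // t /clip_params_square[].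
have [d12|/ltW d21] := lerP `|q.1 - p.1| `|q.2 - p.2|.
- have := eucl_dist_le_max _ _ _ _ d12 (lexx _); nra.
- have := eucl_dist_le_max _ _ _ _ (lexx _) d21; nra.
Qed.

(** * Counting edges under low density *)

(** The length threshold [s] is independent of the radius [r]: low density treats [s = r], the
    length classes need smaller [s]. *)
Definition meeting_edges {R : realType} (G : geometric_graph R) (a : R * R)
    (r s : R) : {set vertex G * vertex G} :=
  [set e in edges G | (s < edge_length e) &&
     `[< edge_segment e `&` square a r !=set0 >] ]%SET.

Lemma low_density_ge0 (R : realType) (G : geometric_graph R) (lam : R) :
  low_density G lam -> 0 <= lam.
Proof. by move=> /(_ (0, 0) 1 ltr01) /(le_trans _) ->. Qed.

Lemma edge_length_gt0 (R : realType) (G : geometric_graph R) e :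
  e \in edges G -> 0 < edge_length e.
Proof.
rewrite inE => /andP[e12 _]; apply: eucl_dist_gt0.
by apply: contraTneq e12 => /pos_inj ->; rewrite adj_irr.
Qed.

(* A square around a vertex that is smaller than every edge is met by all the
   edges at this vertex, so low density bounds the degrees. *)
Lemma low_density_card_edges (R : realType) (G : geometric_graph R) (lam : R) :
  low_density G lam -> #|edges G|%:R <= lam * #|vertex G|%:R.
Proof.
move=> Glam.
(* The default 1 keeps [m] positive when there are no edges; [m / 2] makes the length comparison
   strict. *)
pose m := \big[Order.min/1]_(e in edges G) edge_length e.
have m0 : 0 < m by apply: lt_bigmin => // e; exact: edge_length_gt0.
have m2 : m / 2 < m by lra.
have mle e : e \in edges G -> m / 2 < edge_length e.
  by move=> eG; apply: (lt_le_trans m2); exact: bigmin_le_cond.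
have deg v : #|[set e in edges G | e.1 == v]%SET|%:R <= lam.
  have m20 : 0 < m / 2 by lra.
  apply: le_trans (Glam (pos v) (m / 2) m20); rewrite ler_nat.
  apply/subset_leq_card/fintype.subsetP => e; rewrite !finset.in_set => /andP[eG /eqP ev].
  have eE : e \in edges G by rewrite finset.in_set.
  rewrite eG mle //=.
  apply/asboolP; exists (pos v); split; last first.
    by split; rewrite subrr normr0 ltW.
  exists 0; first by rewrite /= in_itv /= lexx ler01.
  by rewrite /seg_point /line_path ev subr0 !mul1r !mul0r !addr0 -surjective_pairing.
have -> : #|edges G|%:R =
    \sum_(v : vertex G) #|[set e in edges G | e.1 == v]%SET|%:R :> R.
  rewrite -natr_sum -sum1_card (partition_big (fun e => e.1) predT) //=.
  congr _%:R; apply: eq_bigr => v _; rewrite -sum1_card.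
  by apply: eq_bigl => e; rewrite finset.in_set.
apply: le_trans (ler_sum _ (fun v _ => deg v)) _.
by rewrite sumr_const mulr_natr.
Qed.

(** The cell is found by the integer part of the offset from [a - r], measured in cell widths
    [2 * r / J]. *)
Lemma subdivision_cell (R : realType) (x a r : R) (J : nat) :
  0 < r -> (0 < J)%N -> `|x - a| <= r ->
  exists i : 'I_J, `|x - (a - r + (2 * i + 1)%N%:R * (r / J%:R))| <= r / J%:R.
Proof.
move=> r0 J0 xa; have JR : 0 < J%:R :> R by rewrite ltr0n.
set s := r / J%:R; have s0 : 0 < s by rewrite divr_gt0.
have rE : r = J%:R * s by rewrite /s mulrC divfK // gt_eqF.
have {xa} /andP[xl xu] : a - r <= x <= a + r by rewrite -ler_distl.
pose y := (x - (a - r)) / (2 * s).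
have yE : x = a - r + y * (2 * s) by rewrite /y divfK ?gt_eqF //; lra.
have y0 : 0 <= y by rewrite divr_ge0 //; lra.
have [yJ|yJ] := ltrP y J%:R.
  have tJ : (Num.truncn y < J)%N by rewrite truncn_lt_nat.
  exists (Ordinal tJ) => /=; have /andP[] := truncn_itv y0.
  rewrite -[(Num.truncn y).+1]addn1 !natrD yE => ? ?.
  rewrite ler_norml; apply/andP; split; nra.
(* At the right end [x = a + r] the integer part is [J], one too large; the last cell is closed and
   contains this point. *)
have tJ : (J.-1 < J)%N by rewrite prednK.
exists (Ordinal tJ) => /=.
have {}yJ : x = a + r by move: xu; rewrite yE; nra.
have -> : (2 * J.-1 + 1)%N%:R = 2 * J%:R - 1 :> R.
  by rewrite -[J in RHS]prednK // -[J.-1.+1]addn1 (natrD _ (2 * _)) natrM natrD; ring.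
rewrite yJ (_ : _ - _ = s) ?(gtr0_norm s0) // rE; ring.
Qed.

Lemma leq_card_bigcup (I T : finType) (F : I -> {set T}) :
  (#|(\bigcup_i F i)%SET| <= \sum_i #|F i|)%N.
Proof.
elim/big_rec2: _ => [|i n A _ leAn]; first by rewrite cards0.
by rewrite (leq_trans (leq_card_setU _ _)) // leq_add2l.
Qed.

Lemma low_density_card_meeting (R : realType) (G : geometric_graph R)
    (lam : R) (a : R * R) (r : R) (J : nat) :
  low_density G lam -> 0 < r -> (0 < J)%N ->
  #|meeting_edges G a r (r / J%:R)|%:R <= lam * J%:R ^+ 2.
Proof.
move=> Glam r0 J0; set s := r / J%:R.
have s0 : 0 < s by rewrite divr_gt0 ?ltr0n.
pose c (ij : 'I_J * 'I_J) : R * R :=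
  (a.1 - r + (2 * ij.1 + 1)%N%:R * s, a.2 - r + (2 * ij.2 + 1)%N%:R * s).
have sub : meeting_edges G a r s \subset (\bigcup_ij meeting_edges G (c ij) s s)%SET.
  apply/fintype.subsetP => e; rewrite inE => /and3P[eG es /asboolP[p [ep [p1 p2]]]].
  have [i pi] := @subdivision_cell _ _ _ _ J r0 J0 p1.
  have [j pj] := @subdivision_cell _ _ _ _ J r0 J0 p2.
  apply/finset.bigcupP; exists (i, j) => //; rewrite inE eG es.
  by apply/asboolP; exists p.
have := leq_trans (subset_leq_card sub) (leq_card_bigcup _ _ _).
rewrite -(ler_nat R) => /le_trans; apply; rewrite natr_sum.
apply: le_trans (ler_sum _ (fun ij _ => Glam (c ij) s s0)) _.
by rewrite sumr_const card_prod card_ord -natrX -mulnn mulr_natr.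
Qed.

(** * From low density to packedness *)

(* Abel summation over the length classes (r/(j+2), r/(j+1)]. *)
Lemma le_sum_length_classes (R : realFieldType) (r x : R) (m : nat) :
  0 < r -> x <= r ->
  x <= r / m.+1%:R +
       \sum_(j < m) (r / j.+1%:R - r / j.+2%:R) * (r / j.+2%:R < x)%R%:R.
Proof.
move=> r0 xr; have le_div j : r / j.+2%:R <= r / j.+1%:R.
  by rewrite ler_pM2l // lef_pV2 ?posrE ?ltr0n // ler_nat.
elim: m => [|m IH]; first by rewrite big_ord0 addr0 divr1.
rewrite big_ord_recr /=; case: ltP => [_|xle].
  by rewrite mulr1 addrCA (addrC _ (_ - _)) subrK addrC.
rewrite mulr0 addr0 (le_trans xle) // lerDl.
by apply: sumr_ge0 => j _; rewrite mulr_ge0 // subr_ge0.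
Qed.

(** An edge missing the square contributes 0, one longer than [r] at most [4 * r], any other at most
    its length. Writing [r / 1%:R] makes the last term the case [J = 1] of the subdivision count. *)
Lemma clipped_length_le_classes (R : realType) (G : geometric_graph R)
    (a : R * R) (r : R) (m : nat) e :
  0 < r -> e \in edges G ->
  clipped_length (square a r) (pos e.1) (pos e.2) <=
    r / m.+1%:R +
    \sum_(j < m) (r / j.+1%:R - r / j.+2%:R) *
      (e \in meeting_edges G a r (r / j.+2%:R))%:R +
    4 * r * (e \in meeting_edges G a r (r / 1%:R))%:R.
Proof.
move=> r0 eG; have le_div j : 0 <= r / j.+1%:R - r / j.+2%:R.
  by rewrite subr_ge0 ler_pM2l // lef_pV2 ?posrE ?ltr0n // ler_nat.
have rm : 0 <= r / m.+1%:R by rewrite divr_ge0 // ltW.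
have sum0 : 0 <= \sum_(j < m) (r / j.+1%:R - r / j.+2%:R) *
      (e \in meeting_edges G a r (r / j.+2%:R))%:R.
  by apply: sumr_ge0 => j _; rewrite mulr_ge0.
have [meets|/clipped_length_disjoint ->] :=
    pselect (segment (pos e.1) (pos e.2) `&` square a r !=set0); last first.
  by rewrite addr_ge0 ?addr_ge0 ?mulr_ge0 // ltW.
have inE' s : (e \in meeting_edges G a r s) = (s < edge_length e).
  by rewrite [LHS]inE eG (asboolT meets) andbT.
rewrite inE' divr1; case: ltP => [_|len_le_r].
  rewrite (le_trans (clipped_length_le_radius _ _ _ _ _ r0)) //.
  by rewrite mulr1 lerDr addr_ge0.
rewrite mulr0 addr0 (le_trans (clipped_length_le_dist _ _ _ _ _)) //.
rewrite (le_trans (le_sum_length_classes _ _ _ m r0 len_le_r)) // lerD2l.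
by apply: ler_sum => j _; rewrite inE'.
Qed.

(** The three summands come from at most [lam * n] residual lengths [r / (m + 1)], from the [m]
    length classes, and from the edges longer than [r]. *)
Lemma low_density_packed_classes (R : realType) (G : geometric_graph R)
    (lam : R) (m : nat) :
  low_density G lam ->
  packed G (lam * (#|vertex G|%:R / m.+1%:R + 2 * m%:R + 4)).
Proof.
move=> Glam a r r0; have lam0 := low_density_ge0 _ _ _ Glam.
apply: le_trans (ler_sum _ (fun e eG =>
  @clipped_length_le_classes _ _ a r m e r0 eG)) _.
rewrite !big_split /= sumr_const -!mulr_sumr exchange_big /=.
have cnt s : \sum_(e in edges G) (e \in meeting_edges G a r s)%:R =
    #|meeting_edges G a r s|%:R :> R.
  rewrite -natr_sum -sum1_card -big_mkcondr /=; congr _%:R.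
  by apply: eq_bigl => e; rewrite [in RHS]inE; rewrite [X in _ && X]inE andbA andbb.
under eq_bigr do rewrite -mulr_sumr cnt.
rewrite cnt.
have h1 : (r / m.+1%:R) *+ #|edges G| <= lam * (#|vertex G|%:R / m.+1%:R) * r.
  rewrite -mulr_natl (_ : _ * r = lam * #|vertex G|%:R * (r / m.+1%:R)); last ring.
  by rewrite ler_wpM2r ?divr_ge0 ?(ltW r0) // low_density_card_edges.
have h2 : #|meeting_edges G a r (r / 1%:R)|%:R <= lam * 1%:R ^+ 2.
  exact: low_density_card_meeting.
have h3 : \sum_(j < m) (r / j.+1%:R - r / j.+2%:R) *
    #|meeting_edges G a r (r / j.+2%:R)|%:R <= lam * (2 * m%:R) * r.
  have -> : lam * (2 * m%:R) * r = \sum_(j < m) 2 * lam * r.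
    by rewrite sumr_const card_ord -mulr_natr; ring.
  apply: ler_sum => j _.
  have J1 : 1 <= j.+1%:R :> R by rewrite ler1n.
  have -> : r / j.+1%:R - r / j.+2%:R = r / (j.+1%:R * j.+2%:R).
    by rewrite -[j.+2]addn1 natrD; field; rewrite !gt_eqF //; lra.
  apply: le_trans (ler_wpM2l _ (low_density_card_meeting _ _ _ a r j.+2 Glam r0 _)) _ => //.
    by rewrite divr_ge0 ?mulr_ge0 // ltW.
  (* The factor is [(j + 2) / (j + 1)], at most 2. *)
  have -> : r / (j.+1%:R * j.+2%:R) * (lam * j.+2%:R ^+ 2) =
      (1 + j.+1%:R^-1) * (lam * r).
    by rewrite -[j.+2]addn1 natrD; field; rewrite !gt_eqF //; lra.
  rewrite -mulrA ler_wpM2r ?mulr_ge0 ?(ltW r0) //.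
  by rewrite (_ : 2 = 1 + 1) // lerD2l invf_le1 // ltr0n.
have h4 : 4 * r * #|meeting_edges G a r (r / 1%:R)|%:R <= lam * 4 * r.
  rewrite -mulrA mulrCA [leRHS]mulrC ler_pM2l //.
  by move: h2; rewrite expr1n mulr1; lra.
apply: le_trans (lerD (lerD h1 h3) h4) _.
by rewrite -!mulrDl -!mulrDr.
Qed.

Lemma low_density_packed (R : realType) (G : geometric_graph R) (lam : R) :
  low_density G lam -> packed G (8 * (lam * Num.sqrt #|vertex G|%:R)).
Proof.
move=> Glam a r r0; have lam0 := low_density_ge0 _ _ _ Glam.
(* Without vertices [1 <= s] fails, but the sum is empty. *)
have [n0|n0] := posnP #|vertex G|.
  rewrite big_pred0 ?n0 ?sqrtr0 ?mulr0 ?mul0r // => -[v w].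
  by have := fintype0 v n0.
set s : R := Num.sqrt _.
have s1 : 1 <= s by rewrite -sqrtr1 ler_sqrt ?ler1n // ler0n.
have ss : #|vertex G|%:R = s * s by rewrite -expr2 sqr_sqrtr.
have /andP[m1 m2] := truncn_itv (le_trans ler01 s1).
(* As [m <= s < m + 1] and [1 <= s], the terms are at most [s], [2 * s] and [4 * s], within
   [8 * s]. *)
set m := Num.truncn s in m1 m2.
apply: le_trans (low_density_packed_classes _ _ _ m Glam a r r0) _.
rewrite ler_pM2r // mulrCA ler_wpM2l // ss.
have : s * s / m.+1%:R <= s.
  by rewrite ler_pdivrMr ?ltr0n // ler_pM2l ?ltW //; lra.
move: (s * s / _) => q; clear -s1 m1; lra.
Qed.

(** Each square only bounds [c] from below, so the infimum of the admissible constants is itself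
    admissible. *)
Lemma packed_is_packedness (R : realType) (G : geometric_graph R) (c : R) :
  packed G c -> exists c', is_packedness G c' /\ c' <= c.
Proof.
move=> Gc; have lb : has_lbound [set c' | packed G c'].
  exists 0 => c' /(_ (0, 0) 1 ltr01); rewrite mulr1; apply: le_trans.
  by apply: sumr_ge0 => e _; exact: clipped_length_ge0.
exists (inf [set c' | packed G c']); split; last exact: inf_lbound.
split; last by move=> c'; exact: inf_lbound.
move=> a r r0; rewrite -ler_pdivrMr //.
apply: lb_le_inf; first by exists c.
by move=> c' Gc'; rewrite ler_pdivrMr //; exact: Gc'.
Qed.

(** * Low density of the grid *)

(** No coordinate varies along the segment by more than its length. *)
Lemma segment_square_endpoints (R : realType) (p q a : R * R) (r : R) :
  segment p q `&` square a r !=set0 ->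
  square a (r + eucl_dist p q) p /\ square a (r + eucl_dist p q) q.
Proof.
move=> [_ [[t + <-]]]; rewrite /= in_itv /= => tI [].
have := eucl_dist_coord1 _ p q; have := eucl_dist_coord2 _ p q.
rewrite /square /seg_point /line_path /= !ler_norml.
by move=> /andP[? ?] /andP[? ?] /andP[? ?] /andP[? ?]; split; split;
  apply/andP; split; nra.
Qed.

Lemma edge_length_grid (R : realType) (k : nat) e :
  e \in edges (grid R k) -> edge_length e = 1.
Proof. by rewrite inE => /andP[/eqP]. Qed.

(** Both coordinates are within [s < 2] of [x], so they differ by less than 4. *)
Lemma eq_mod4_near (R : realType) (k : nat) (u v : 'I_k) (x s : R) :
  s < 2 -> `|u.+1%:R - x| <= s -> `|v.+1%:R - x| <= s ->
  (u = v %[mod 4])%N -> u = v.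
Proof.
move=> s2; rewrite !ler_norml => /andP[u1 u2] /andP[v1 v2] uv.
have uv4 : (u < v + 4)%N by rewrite -(ltr_nat R) natrD; move: u2 v1; rewrite -!natr1; lra.
have vu4 : (v < u + 4)%N by rewrite -(ltr_nat R) natrD; move: u1 v2; rewrite -!natr1; lra.
by apply: val_inj => /=; lia.
Qed.

(* An edge of length greater than r exists only if r < 1, and then its
   endpoints are within 2 of the centre of any square of radius r it meets, so
   that they are determined by their coordinates modulo 4. *)
Lemma grid_low_density (R : realType) (k : nat) : low_density (grid R k) 256.
Proof.
move=> a r r0; rewrite -/(meeting_edges _ _ _ _) ler_nat.
pose red (v : 'I_k * 'I_k) : 'I_4 * 'I_4 := (inord (v.1 %% 4), inord (v.2 %% 4)).
have red_inj (u v : 'I_k * 'I_k) s : s < 2 ->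
    square a s (grid_pos R u) -> square a s (grid_pos R v) -> red u = red v -> u = v.
  have inord_inj (i j : 'I_k) : inord (i %% 4) = inord (j %% 4) :> 'I_4 -> (i = j %[mod 4])%N.
    by move=> /(congr1 val) /=; rewrite !inordK ?ltn_mod.
  case: u v => [u1 u2] [v1 v2] s2 [/= hu1 hu2] [/= hv1 hv2] [/inord_inj e1 /inord_inj e2].
  by rewrite (eq_mod4_near _ _ _ _ _ _ s2 hu1 hv1 e1) (eq_mod4_near _ _ _ _ _ _ s2 hu2 hv2 e2).
(* The residues of the four coordinates give [4 ^ 4 = 256] codes. *)
pose f (e : ('I_k * 'I_k) * ('I_k * 'I_k)) := (red e.1, red e.2).
have f_inj : {in meeting_edges (grid R k) a r r &, injective f}.
  move=> [u1 u2] [v1 v2]; rewrite inE => /and3P[eu]; rewrite edge_length_grid // => r1.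
  move=> /asboolP/segment_square_endpoints; rewrite -/(edge_length (_, _)).
  rewrite edge_length_grid // => -[hu1 hu2].
  rewrite inE => /and3P[ev _ /asboolP/segment_square_endpoints].
  rewrite -/(edge_length (_, _)) edge_length_grid // => -[hv1 hv2] uv.
  have r2 : r + 1 < 2 by lra.
  congr pair; apply: (red_inj _ _ (r + 1)) => //.
  - by have := congr1 fst uv.
  - by have := congr1 snd uv.
rewrite -(card_in_imset f_inj) (leq_trans (max_card _)) //.
by rewrite !card_prod !card_ord.
Qed.

(** * Lower bound for the grid *)

(** Ordered adjacent pairs can be counted without reference to the enumeration order that [edges]
    uses. *)
Lemma card_adj_le_edges (R : realType) (G : geometric_graph R) :
  (#|[set e : vertex G * vertex G | adj e.1 e.2]%SET| <= 2 * #|edges G|)%N.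
Proof.
pose swap (e : vertex G * vertex G) := (e.2, e.1).
have sub : [set e : vertex G * vertex G | adj e.1 e.2]%SET \subset
    (edges G :|: [set swap e | e in edges G])%SET.
  apply/fintype.subsetP => -[u v]; rewrite !inE /= => uv.
  rewrite uv; case: ltngtP => //= [vu|uvr].
    by apply/imsetP; exists (v, u) => //; rewrite inE /= adj_sym uv.
  by move: uv; rewrite (enum_rank_inj (ord_inj uvr)) adj_irr.
rewrite (leq_trans (subset_leq_card sub)) // (leq_trans (leq_card_setU _ _)) //.
by rewrite mul2n -addnn leq_add2l leq_imset_card.
Qed.

(** It suffices to count the ordered pairs that raise the second coordinate by 1, one for each of
    [(k + 1) * k] index pairs. *)
Lemma grid_card_edges (R : realType) (k : nat) :
  (k.+1 * k <= 2 * #|edges (grid R k.+1)|)%N.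
Proof.
pose f (ij : 'I_k.+1 * 'I_k) : ('I_k.+1 * 'I_k.+1) * ('I_k.+1 * 'I_k.+1) :=
  ((ij.1, widen_ord (leqnSn k) ij.2), (ij.1, lift ord0 ij.2)).
have f_inj : injective f.
  by move=> [i j] [i' j'] [-> /val_inj ->].
apply: leq_trans (card_adj_le_edges _ _).
rewrite -[X in (X <= _)%N](_ : #|[set f ij | ij : 'I_k.+1 * 'I_k]%SET| = _); last first.
  by rewrite card_imset // card_prod !card_ord.
apply/subset_leq_card/fintype.subsetP => _ /imsetP[[i j] _ ->].
rewrite inE /= /grid_adj /eucl_dist /= /bump /= add1n.
by rewrite subrr expr0n add0r -[j.+2%:R]natr1 opprD addrA subrr sub0r sqrrN expr1n sqrtr1.
Qed.

Lemma grid_packed_ge (R : realType) (k : nat) (c : R) :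
  packed (grid R k.+1) c -> k%:R / 2 <= c.
Proof.
have k0 : 0 < k.+1%:R :> R by rewrite ltr0n.
move=> /(_ (0, 0) k.+1%:R k0).
rewrite (eq_bigr (fun=> 1)) => [|e eG]; last first.
  rewrite clipped_length_subset; first exact: (edge_length_grid _ _ _ eG).
  have itv (i : 'I_k.+1) : 0 <= (i.+1%:R : R) <= k.+1%:R.
    by rewrite ler0n ler_nat ltn_ord.
  move: e {eG} => [[u1 u2] [v1 v2]] _ [t + <-]; rewrite /= in_itv /= => tI.
  have := itv u1; have := itv u2; have := itv v1; have := itv v2.
  rewrite /square /seg_point /line_path /= !subr0 !ler_norml => *.
  by split; apply/andP; split; nra.
rewrite sumr_const => Ec.
have := grid_card_edges R k; rewrite -(ler_nat R) !natrM => kE.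
rewrite -(ler_pM2r k0); nra.
Qed.

Theorem mainTheorem2 (R : realType) :
  (exists K : R, 0 < K /\
     forall (G : geometric_graph R) (lam : R), low_density G lam ->
       exists c : R, is_packedness G c /\
         c <= K * (lam * Num.sqrt #|vertex G|%:R)) /\
  (exists lam : R, forall k : nat, low_density (grid R k) lam) /\
  (exists c : nat -> R,
     (forall k : nat, is_packedness (grid R k) (c k)) /\
     exists A B : R, 0 < A /\ 0 < B /\
       \forall k \near \oo,
         A * Num.sqrt (k ^ 2)%N%:R <= c k <= B * Num.sqrt (k ^ 2)%N%:R).
Proof.
have upper (G : geometric_graph R) (lam : R) : low_density G lam ->
    exists c : R, is_packedness G c /\ c <= 8 * (lam * Num.sqrt #|vertex G|%:R).
  by move=> Glam; apply: packed_is_packedness; exact: low_density_packed.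
split; first by exists 8; split.
split; first by exists 256 => k; exact: grid_low_density.
have [c cP] := boolp.choice (fun k => upper _ _ (grid_low_density R k)).
exists c; split=> [k|]; first by case: (cP k).
(* For side [k + 1] with [k >= 1], the lower bound [k / 2] is at least [(k + 1) / 4]; [8 * 256] is
   the general constant times the density constant. *)
exists (1 / 4), (8 * 256); split; first by rewrite divr_gt0.
split; first by rewrite mulr_gt0.
(* Side 1 is excluded: that grid has no edges and packedness 0. *)
exists 2%N => // -[|k] //= k1; have [[ck _]] := cP k.+1.
rewrite card_prod card_ord mulnn mulrA => -> /=; rewrite andbT.
rewrite natrX sqrtr_sqr ger0_norm //.
apply: le_trans (grid_packed_ge _ _ _ ck).
have : 1 <= k%:R :> R by rewrite ler1n.
rewrite -[k.+1%:R]natr1. lra.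
Qed.
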